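(* Let $G$ be a connected plane graph with edge weights, symmetric with respect to reflection across a horizontal line $\ell$ (the weight function being invariant under this reflection), and denote its vertices on $\ell$, from left to right, by $a_1,b_1,a_2,b_2,\dots,a_k,b_k$. Let $E=\{e_1,\dots,e_s\}$ be a set of $s\le k$ pairwise disjoint edges of $G$, each incident to exactly one of the vertices $a_1,\dots,a_k$. For an edge $e$ let $e'$ denote its reflection across $\ell$. For $I\subseteq[s]$ let $$\mathcal{M}_E^I(G)=\{\mu \text{ a perfect matching of } G:\ e_i\in\mu \text{ for } i\in I,\ e'_i\in\mu \text{ for } i\in[s]\setminus I\}.$$ Then the sum of the weights of the perfect matchings in $\mathcal{M}_E^I(G)$ is the same for all $I\subseteq[s]$.
   Context: Graphs have no loops or multiple edges. The weight of a perfect matching is the product of the weights of its edges. Some edges of $E$ may lie along $\ell$, in which case $e'=e$. *)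

(* Defs.v *)
From HB Require Import structures.
From mathcomp Require Import all_boot all_order all_algebra.
From mathcomp Require Import all_classical all_reals all_analysis.

Set Implicit Arguments.
Unset Strict Implicit.
Unset Printing Implicit Defensive.

Import Order.TTheory GRing.Theory Num.Theory.
Import numFieldNormedType.Exports.

Local Open Scope classical_set_scope.
Local Open Scope ring_scope.

(* [A] is a simple (not necessarily polygonal) arc of the plane with endpoints
   [p] and [q], both of which belong to [A]. *)
Definition is_arc (R : realType) (A : set (R * R)) (p q : R * R) : Prop :=
  exists gamma : R -> R * R,
    [/\ {within `[0, 1], continuous gamma},
        set_inj `[0, 1] gamma,
        gamma 0 = p,
        gamma 1 = q
      & gamma @` `[0, 1] = A].

Definition edge_set (V : finType) (adj : rel V) : {set {set V}} :=
  [set e : {set V} |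
    [exists x, exists y, adj x y && (e == [set x; y]%SET)]]%SET.

(* A finite simple graph together with an embedding in the plane. An edge is the
   pair of its endpoints, so there are no multiple edges; the values of [pg_arc]
   at sets of vertices that are not edges are irrelevant. *)
Record plane_graph (R : realType) := PlaneGraph {
  pg_vertex :> finType;
  pg_adj : rel pg_vertex;
  pg_adj_sym : symmetric pg_adj;
  pg_adj_irr : irreflexive pg_adj;
  pg_pos : pg_vertex -> R * R;
  pg_arc : {set pg_vertex} -> set (R * R);
  pg_pos_inj : injective pg_pos;
  pg_arcP : forall x y : pg_vertex, pg_adj x y ->
    is_arc (pg_arc [set x; y]%SET) (pg_pos x) (pg_pos y);
  pg_arc_vertex : forall (e : {set pg_vertex}) (v : pg_vertex),
    e \in edge_set pg_adj -> pg_arc e (pg_pos v) -> v \in e;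
  pg_arc_disjoint : forall (e f : {set pg_vertex}) (p : R * R),
    e \in edge_set pg_adj -> f \in edge_set pg_adj -> e != f ->
    pg_arc e p -> pg_arc f p ->
    exists v : pg_vertex, [/\ v \in e, v \in f & p = pg_pos v]
}.

Section PlaneGraph.
Variables (R : realType) (G : plane_graph R).

Definition pg_edges : {set {set G}} := edge_set (@pg_adj R G).

Definition pg_connected : Prop :=
  (0 < #|G|)%N /\ forall x y : G, connect (@pg_adj R G) x y.

(* Reflection across the horizontal line of equation y = c. *)
Definition mirror (c : R) (p : R * R) : R * R := (p.1, c *+ 2 - p.2).

Definition on_line (c : R) (v : G) : Prop := (pg_pos v).2 = c.

(* The vertices located at the mirror images of those of [e]; when [G] is
   symmetric and [e] is an edge, this is the reflected edge e'. *)
Definition mirror_edge (c : R) (e : {set G}) : {set G} :=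
  [set v : G | [exists u in e, pg_pos v == mirror c (pg_pos u)]]%SET.

Definition pg_symmetric (c : R) : Prop :=
  (forall v : G, exists v' : G, pg_pos v' = mirror c (pg_pos v)) /\
  (forall e : {set G}, e \in pg_edges ->
     mirror_edge c e \in pg_edges /\
     pg_arc (mirror_edge c e) = mirror c @` pg_arc e).

Definition perfect_matching (mu : {set {set G}}) : bool :=
  (mu \subset pg_edges) &&
  [forall v : G, #|[set e in mu | v \in e]%SET| == 1%N].

Definition matchings_through (c : R) (s : nat) (E : 'I_s -> {set G})
    (I : {set 'I_s}) : {set {set {set G}}} :=
  [set mu : {set {set G}} | perfect_matching mu &&
    [forall i, (if i \in I then E i else mirror_edge c (E i)) \in mu]]%SET.

Definition matching_weight (W : comNzRingType) (wt : {set G} -> W)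
    (mu : {set {set G}}) : W :=
  \prod_(e in mu) wt e.

End PlaneGraph.

(* Main.v *)
Require Import Defs.
From HB Require Import structures.
From mathcomp Require Import all_boot all_order all_algebra.
From mathcomp Require Import all_classical all_reals all_analysis.
From mathcomp Require Import lra zify.

Set Implicit Arguments.
Unset Strict Implicit.
Unset Printing Implicit Defensive.

Import Order.TTheory GRing.Theory Num.Theory.
Import numFieldNormedType.Exports.

Local Open Scope ring_scope.

(* Let [rho] be the reflection followed by the matching [mu], both seen as
   involutions of the vertices. The orbit of a vertex [v] of the line under both
   is the [rho]-orbit of [v]; since [mu] has no fixed vertex, that orbit has even
   length and contains exactly one other vertex of the line, the antipode of [v].
   Folding the plane onto a closed half-plane turns the edges met by the orbit
   into a curve from [v] to its antipode, and distinct orbits give disjoint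
   curves. Hence the pairing of the vertices of the line is noncrossing, and
   never pairs two of the [a i]. So reflecting [mu] inside the orbit of the end
   [a j] of [E i] exchanges [E i] with its mirror image and leaves the other
   prescribed edges alone, which gives a weight-preserving involution. *)

(** * Interleaved chains in a half-plane *)

(** Parity of the number of steps of the chain [x :: s] at which [f] holds. Winding is only counted
    modulo 2. *)
Fixpoint consecutive_xor (T : Type) (f : T -> T -> bool) (x : T) (s : seq T) :=
  if s is y :: s' then f x y (+) consecutive_xor f y s' else false.

Section DiscreteCrossing.
Variable R : realType.
Implicit Types (p q r t x y z : R * R) (s u : seq (R * R)) (e : R).

Definition nearby e p q := (`|p.1 - q.1| < e) && (`|p.2 - q.2| < e).

(* Does the segment from [p] to [q], for nearby [p] and [q] away from 0, cross
   the positive half-axis? *)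
Definition ray_cross p q :=
  [&& 0 < p.1, 0 < q.1 & (0 <= p.2) (+) (0 <= q.2)].

(** The sign change forces [|p.2| < e], so [p] stays off the box around 0 through its first
    coordinate, [e <= |p.1|]; a point within [e] of [p] then lies on the same side. *)
Lemma sign_fst e p q r : ~~ nearby e p 0 -> nearby e p q -> nearby e p r ->
  (0 <= p.2) != (0 <= q.2) -> (0 < r.1) = (0 < p.1).
Proof.
rewrite /nearby /= !subr0 negb_and -!leNgt.
move=> Hp /andP[_ /ltr_normlP[Hq1 Hq2]] /andP[/ltr_normlP[Hr1 Hr2] _] Hs.
have Hp2 : `|p.2| < e.
  apply/ltr_normlP; move: Hs.
  by case: (lerP 0 p.2) => hp; case: (lerP 0 q.2) => hq // _; split; lra.
move: Hp; rewrite (leNgt _ `|p.2|) Hp2 orbF ler_normr => /orP[] h.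
  by have [-> ->] : 0 < r.1 /\ 0 < p.1 by lra.
have [r0 p0] : r.1 < 0 /\ p.1 < 0 by lra.
by rewrite !ltNge (ltW r0) (ltW p0).
Qed.

(** The quadrilateral [p], [q], [r], [t] is too small to surround 0, so its four sides cross the
    half-axis an even number of times. *)
Lemma ray_cross_square e p q r t :
  {in [:: p; q; r; t], forall x, ~~ nearby e x 0} ->
  {in [:: p; q; r; t] &, forall x y, nearby e x y} ->
  ray_cross p q (+) ray_cross t r = ray_cross p t (+) ray_cross q r.
Proof.
move=> h0 hc.
have mp : p \in [:: p; q; r; t] by rewrite !inE eqxx ?orbT.
have mq : q \in [:: p; q; r; t] by rewrite !inE eqxx ?orbT.
have mr : r \in [:: p; q; r; t] by rewrite !inE eqxx ?orbT.
have mt : t \in [:: p; q; r; t] by rewrite !inE eqxx ?orbT.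
have key x y z : x \in [:: p; q; r; t] -> y \in [:: p; q; r; t] ->
    z \in [:: p; q; r; t] -> (0 <= x.2) != (0 <= y.2) -> (0 < z.1) = (0 < x.1).
  by move=> hx hy hz; apply: sign_fst; [apply: h0 | apply: hc | apply: hc].
rewrite /ray_cross.
(* If some second coordinate differs in sign from that of [p], all first coordinates share a sign
   and the crossings cancel; otherwise no side crosses. *)
have [y1|] := eqVneq (0 <= p.2) (0 <= q.2); last first.
  move=> /(key p q) k; rewrite (k q) // (k r) // (k t) //.
  by case: (0 < p.1) => //=; do 4 case: (0 <= _).
have [y2|] := eqVneq (0 <= p.2) (0 <= r.2); last first.
  move=> /(key p r) k; rewrite (k q) // (k r) // (k t) //.
  by case: (0 < p.1) => //=; do 4 case: (0 <= _).
have [y3|] := eqVneq (0 <= p.2) (0 <= t.2); last first.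
  move=> /(key p t) k; rewrite (k q) // (k r) // (k t) //.
  by case: (0 < p.1) => //=; do 4 case: (0 <= _).
by rewrite -y1 -y2 -y3 addbb !andbF.
Qed.

Lemma ray_cross_upper p q : 0 <= p.2 -> 0 <= q.2 -> ray_cross p q = false.
Proof. by move=> hp hq; rewrite /ray_cross hp hq !andbF. Qed.

(** The axis counts as upper, so inside the closed lower half-plane a crossing means entering or
    leaving the positive half-axis. This form telescopes along a chain. *)
Lemma ray_cross_lower e p q : ~~ nearby e p 0 -> nearby e p q -> 0 < e ->
    p.2 <= 0 -> q.2 <= 0 -> ray_cross p q =
  (0 < p.1) && (0 <= p.2) (+) (0 < q.1) && (0 <= q.2).
Proof.
move=> h0 hc e0 hp hq; rewrite /ray_cross.
have hpp : nearby e p p by rewrite /nearby !subrr normr0 e0.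
have [y1|] := eqVneq (0 <= p.2) (0 <= q.2); last first.
  move=> /(sign_fst h0 hc hc) ->.
  by case: (0 < p.1) => //=; do 2 case: (0 <= _).
rewrite -y1 addbb !andbF; case: (lerP 0 p.2) => h; rewrite ?andbF ?andbT //.
have p2 : p.2 = 0 by lra.
move: h0 hc; rewrite /nearby /= !subr0 p2 normr0 e0 andbT -leNgt.
rewrite ler_normr => h0 /andP[/ltr_normlP[h1 h2] _].
by case/orP: h0 => h0; case: (ltrP 0 p.1); case: (ltrP 0 q.1) => //; lra.
Qed.

Lemma consecutive_xor_telescope (e : rel (R * R)) (f : R * R -> R * R -> bool)
    (g : R * R -> bool) x s : path e x s ->
  {in x :: s &, forall p q, e p q -> f p q = g p (+) g q} ->
  consecutive_xor f x s = g x (+) g (last x s).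
Proof.
elim: s x => [|y s IH] x /=; first by rewrite addbb.
case/andP=> exy pys fg; rewrite fg ?inE ?eqxx ?orbT // IH //.
  by rewrite addbA addbK.
by move=> p q hp hq; apply: fg; rewrite inE ?hp ?hq orbT.
Qed.

(** Each step from [x] to [y] gives a quadrilateral [x - z], [y - z], [y - z'], [x - z']; the sides
    shared by successive quadrilaterals cancel. Both points may move by [e], hence the bound
    [e *+ 2]. *)
Lemma crossings_shift e z z' x s : 0 < e -> nearby e z z' -> path (nearby e) x s ->
  {in x :: s, forall p, ~~ nearby (e *+ 2) p z && ~~ nearby (e *+ 2) p z'} ->
  consecutive_xor (fun p q => ray_cross (p - z) (q - z)) x s (+)
  consecutive_xor (fun p q => ray_cross (p - z') (q - z')) x s =
  ray_cross (x - z) (x - z') (+) ray_cross (last x s - z) (last x s - z').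
Proof.
move=> e0 czz; elim: s x => [|y s IH] x /=; first by rewrite addbb.
case/andP=> cxy pys far.
have := IH y pys _; rewrite addbACA => ->; last by move=> p hp; apply: far; rewrite inE hp orbT.
rewrite addbA; congr (_ (+) _).
rewrite (@ray_cross_square (e *+ 2) _ _ (y - z')) //; first by rewrite addbK.
  have /andP[x1 x2] := far x (mem_head _ _).
  have /andP[y1 y2] : ~~ nearby (e *+ 2) y z && ~~ nearby (e *+ 2) y z'.
    by apply: far; rewrite !inE eqxx orbT.
  by move=> p; rewrite !inE => /or4P[] /eqP->; move: x1 x2 y1 y2;
    rewrite /nearby /= !subr0.
have h1 : `|x.1 - y.1| < e by case/andP: cxy.
have h2 : `|x.2 - y.2| < e by case/andP: cxy.
have h3 : `|z.1 - z'.1| < e by case/andP: czz.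
have h4 : `|z.2 - z'.2| < e by case/andP: czz.
move: h1 h2 h3 h4 => /ltr_normlP[? ?] /ltr_normlP[? ?] /ltr_normlP[? ?] /ltr_normlP[? ?].
move=> p q; rewrite !inE => /or4P[] /eqP-> /or4P[] /eqP->; rewrite /nearby /=;
 by apply/andP; split; apply/ltr_normlP; split; rewrite mulr2n; lra.
Qed.

(** [crossings_shift] summed along [z :: u]: opposite pairs of sides of the rectangle of index pairs
    have equal crossing parity. *)
Lemma crossings_transport e z u x s : 0 < e -> path (nearby e) z u ->
  path (nearby e) x s ->
  (forall p q, p \in x :: s -> q \in z :: u -> ~~ nearby (e *+ 2) p q) ->
  consecutive_xor (fun p q => ray_cross (p - z) (q - z)) x s (+)
  consecutive_xor (fun p q => ray_cross (p - last z u) (q - last z u)) x s =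
  consecutive_xor (fun p q => ray_cross (x - p) (x - q)) z u (+)
  consecutive_xor (fun p q => ray_cross (last x s - p) (last x s - q)) z u.
Proof.
move=> e0; elim: u z => [|z' u IH] z /=; first by rewrite addbb.
move=> /andP[czz pzu] pxs far.
rewrite -[X in X (+) _](addbK
  (consecutive_xor (fun p q => ray_cross (p - z') (q - z')) x s)) -addbA.
rewrite (crossings_shift e0 czz pxs); last first.
  by move=> p hp; rewrite !far ?inE ?eqxx ?orbT.
rewrite IH //; last by move=> p q hp hq; apply: far => //; rewrite inE hq orbT.
exact: addbACA.
Qed.

(* The differences [p - q], for [p] on one chain and [q] on the other, would
   wind once around 0 along the boundary of the rectangle of index pairs. *)
Lemma interleaved_chains_meet e z u x s : 0 < e ->
  path (nearby e) z u -> path (nearby e) x s ->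
  {in x :: s, forall p, 0 <= p.2} -> {in z :: u, forall p, 0 <= p.2} ->
  x.2 = 0 -> z.2 = 0 -> (last x s).2 = 0 -> (last z u).2 = 0 ->
  x.1 < z.1 -> z.1 < (last x s).1 -> (last x s).1 < (last z u).1 ->
  exists p q, [/\ p \in x :: s, q \in z :: u & nearby (e *+ 2) p q].
Proof.
move=> e0 pzu pxs xs0 zu0 x0 z0 lx0 lz0 lt1 lt2 lt3.
apply/not_existsP => nex.
have far p q : p \in x :: s -> q \in z :: u -> ~~ nearby (e *+ 2) p q.
  by move=> hp hq; apply/negP => hc; apply: (nex p); exists q.
(* Differences with a base point on the axis remain in the upper half-plane here, and in the lower
   one in [lower]. *)
have upper w : w.2 = 0 ->
    consecutive_xor (fun p q => ray_cross (p - w) (q - w)) x s = false.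
  move=> w0; rewrite (consecutive_xor_telescope (g := fun=> false) pxs) //.
  by move=> p q hp hq _; rewrite ray_cross_upper //= w0 subr0; apply: xs0.
have lower w : w \in x :: s -> w.2 = 0 ->
    consecutive_xor (fun p q => ray_cross (w - p) (w - q)) z u =
    (0 < w.1 - z.1) (+) (0 < w.1 - (last z u).1).
  move=> hw w0.
  rewrite (consecutive_xor_telescope
    (g := fun p => (0 < w.1 - p.1) && (0 <= w.2 - p.2)) pzu).
    by rewrite w0 z0 lz0 subrr lexx !andbT.
  move=> p q hp hq /andP[c1 c2].
  have e2 : e < e *+ 2 by rewrite mulr2n ltrDl.
  apply: (@ray_cross_lower (e *+ 2)); rewrite /= ?w0.
  - by have := far w p hw hp; rewrite /nearby /= !subr0 w0.
  - move: c1 c2 => /ltr_normlP[? ?] /ltr_normlP[? ?].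
    by apply/andP; split; apply/ltr_normlP; split => /=; lra.
  - by rewrite mulrn_wgt0.
  - by rewrite sub0r oppr_le0 zu0.
  - by rewrite sub0r oppr_le0 zu0.
(* The left side vanishes, while of the four comparisons on the right only [z.1 < (last x s).1]
   holds: the parities disagree. *)
have := crossings_transport e0 pzu pxs far.
rewrite !upper // lower ?mem_head // lower ?mem_last //.
rewrite !subr_gt0 lt2 !ltNge.
by rewrite (ltW lt1) (ltW lt3) (ltW (lt_trans lt1 (lt_trans lt2 lt3))).
Qed.

End DiscreteCrossing.

(** * Compact sets of the plane joined by arbitrarily fine chains *)

Section WellChained.
Variable R : realType.
Implicit Types (p q x y : R * R) (K L : set (R * R)) (e : R).
Local Open Scope classical_set_scope.

(** A substitute for path-connectedness that feeds the discrete crossing argument and makes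
    concatenation a mere [++]. *)
Definition well_chained K x y := forall e, 0 < e ->
  exists s, [/\ path (nearby e) x s, last x s = y & {in x :: s, forall p, K p}].

Lemma well_chained_trans K y x z :
  well_chained K x y -> well_chained K y z -> well_chained K x z.
Proof.
move=> xy yz e e0; have [s [s1 s2 s3]] := xy e e0; have [t [t1 t2 t3]] := yz e e0.
exists (s ++ t); rewrite cat_path last_cat s2 s1 t1 t2; split=> // p.
rewrite -cat_cons mem_cat => /orP[/s3 //|pt].
by apply: t3; rewrite inE pt orbT.
Qed.

Lemma well_chained_sub K L x y : K `<=` L -> well_chained K x y -> well_chained L x y.
Proof.
by move=> KL xy e /xy[s [s1 s2 s3]]; exists s; split=> // p /s3; apply: KL.
Qed.

Lemma well_chained_image K (h : R * R -> R * R) x y :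
  (forall e p q, nearby e p q -> nearby e (h p) (h q)) ->
  well_chained K x y -> well_chained (h @` K) (h x) (h y).
Proof.
move=> hh xy e /xy[s [s1 s2 s3]]; exists (map h s); split.
- by apply: homo_path s1 => p q; apply: hh.
- by rewrite last_map s2.
- by rewrite -map_cons => _ /mapP[p /s3 Kp ->]; exists p.
Qed.

(** Uniform continuity of a parametrisation turns a fine subdivision of the unit interval into a
    fine chain. *)
Lemma arc_well_chained A p q : is_arc A p q -> well_chained A p q.
Proof.
case=> g [gc _ <- <- <-] e e0; set I := `[0, 1]%classic in gc *.
have unif : \forall d \near 0^'+, forall t : R, I t -> I t -> forall u, I u ->
    `|t - u| <= d -> nearby e (g t) (g u).
  have /compact_near_coveringP := @segment_compact R 0 1.
  apply => t It.
  have e20 : 0 < e / 2 by rewrite divr_gt0.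
  have /subspace_continuousP/(_ t It)/cvg_ball/(_ _ e20) := gc.
  rewrite /prop_near1 /within /= => /nbhs_ballP[r /= r0 hr].
  (* Half the radius goes to [t'] and half to [d], so that [u] also stays within [r] of [t]. *)
  exists (ball t (r / 2), [set d | d < r / 2]) => /=.
    split; first by apply: nbhsx_ballx; rewrite divr_gt0.
    by apply: nbhs_right_lt; rewrite divr_gt0.
  move=> [t' d] /= [tt' dr] It' u Iu ud.
  have tt'' : `|t - t'| < r / 2 by [].
  have [b1 b2] : ball (g t) (e / 2) (g t').
    by apply: hr => //; rewrite /ball /=; lra.
  have [b3 b4] : ball (g t) (e / 2) (g u).
    apply: hr => //; rewrite /ball /=.
    by rewrite (le_lt_trans (ler_distD t' _ _)) //; lra.
  move: b1 b2 b3 b4; rewrite /ball /=.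
  move=> /ltr_normlP[? ?] /ltr_normlP[? ?] /ltr_normlP[? ?] /ltr_normlP[? ?].
  by apply/andP; split; apply/ltr_normlP; split; lra.
have [d [d0 hd]] : exists d : R, 0 < d /\ forall t u : R, I t -> I u ->
    `|t - u| <= d -> nearby e (g t) (g u).
  near (0 : R)^'+ => d; exists d; split => // t u It Iu.
  by move: t It (It) u Iu; near: d.
have step n : forall t : R, I t -> t <= n%:R * d ->
    exists s, [/\ path (nearby e) (g 0) s, last (g 0) s = g t &
      {in g 0 :: s, forall p, (g @` I) p}].
  have I0 : I 0 by rewrite /I /= in_itv /= lexx ler01.
  elim: n => [|n IH] t It.
    rewrite mul0r => t0.
    have -> : t = 0 by apply/le_anti; rewrite t0;
      move: It; rewrite /I /= in_itv /= => /andP[].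
    exists [::]; split=> // r; rewrite inE => /eqP ->; by exists 0.
  (* The previous point of the subdivision of [[0, t]] into [n.+1] equal pieces, each of length at
     most [d]. *)
  move=> tn; set t' := t * (n%:R / n.+1%:R).
  have n0 : 0 < n.+1%:R :> R by rewrite ltr0n.
  have [t0 t1] : 0 <= t /\ t <= 1 by move: It; rewrite /I /= in_itv /= => /andP[].
  have It' : I t'.
    rewrite /I /= in_itv /= /t' mulr_ge0 ?divr_ge0 ?ler0n //=.
    rewrite (le_trans _ t1) // ler_piMr // ler_pdivrMr // mul1r ler_nat //.
  have dt : t' - t = - (t / n.+1%:R).
    rewrite /t' -[n%:R](addrK 1) -mulrSr mulrBl divff ?gt_eqF //.
    by rewrite mulrBr mulr1 div1r addrAC subrr sub0r.
  have [|s [s1 s2 s3]] := IH t' It'.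
    by rewrite /t' mulrCA ler_wpM2l // ler_pdivrMr // mulrC.
  exists (rcons s (g t)); rewrite rcons_path last_rcons s1 s2; split=> //=.
    apply: hd => //; rewrite dt normrN ger0_norm ?divr_ge0 //.
    by rewrite ler_pdivrMr // mulrC.
  move=> r; rewrite -rcons_cons mem_rcons inE => /orP[/eqP ->|/s3 //].
  by exists t.
have I1 : I 1 by rewrite /I /= in_itv /= lexx ler01.
apply: (step (Num.bound d^-1)) => //.
rewrite -ler_pdivrMr // div1r ltW //.
by have := archi_boundP (ltW (_ : 0 < d^-1)); apply; rewrite invr_gt0.
Unshelve. all: by end_near. Qed.

Lemma compact_arc A p q : is_arc A p q -> compact A.
Proof.
case=> g [gc _ _ _ <-]; apply: continuous_compact => //.
exact: segment_compact.
Qed.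

(** Moving both points by less than [d / 4] leaves a coordinate gap above [d / 2], which exceeds
    [e *+ 2]. *)
Lemma nearby_far (d e : R) p q p' q' :
  (d <= `|p.1 - q.1|) || (d <= `|p.2 - q.2|) ->
  nearby (d / 4) p p' -> nearby (d / 4) q q' -> e < d / 4 ->
  ~~ nearby (e *+ 2) p' q'.
Proof.
move=> hd /andP[/ltr_normlP[? ?] /ltr_normlP[? ?]].
move=> /andP[/ltr_normlP[? ?] /ltr_normlP[? ?]] ?.
apply/negP; rewrite mulr2n => /andP[/ltr_normlP[? ?] /ltr_normlP[? ?]].
by case/orP: hd; rewrite ler_normr => /orP[] ?; lra.
Qed.

(** Distinct points are separated uniformly near each pair by [nearby_far]; compactness of the
    product makes the bound global. *)
Lemma compact_separated K L : compact K -> compact L -> K `&` L = set0 ->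
  \forall e \near 0^'+, forall p q, K p -> L q -> ~~ nearby (e *+ 2) p q.
Proof.
move=> cK cL KL.
suff : \forall e \near (0 : R)^'+, forall z : (R * R) * (R * R), (K `*` L) z ->
    ~~ nearby (e *+ 2) z.1 z.2.
  by apply: filterS => e h p q Kp Lq; apply: (h (p, q)).
have /compact_near_coveringP := compact_setX cK cL.
apply=> -[p q] [/= Kp Lq].
have [D D0 hD] : exists2 D, 0 < D & (D <= `|p.1 - q.1|) || (D <= `|p.2 - q.2|).
  have [e1|n1] := eqVneq p.1 q.1; last first.
    by exists `|p.1 - q.1|; rewrite ?lexx // normr_gt0 subr_eq0.
  have [e2|n2] := eqVneq p.2 q.2; last first.
    by exists `|p.2 - q.2|; rewrite ?lexx ?orbT // normr_gt0 subr_eq0.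
  have pq : p = q by rewrite [p]surjective_pairing e1 e2 -surjective_pairing.
  by exfalso; rewrite -[False]/((set0 : set (R * R)) p) -KL; split; rewrite // pq.
exists (ball (p, q) (D / 4), [set e | e < D / 4]) => /=.
  split; first by apply: nbhsx_ballx; rewrite divr_gt0.
  by apply: nbhs_right_lt; rewrite divr_gt0.
move=> [[p' q'] e] /= [[[b1 b2] [b3 b4]] eD].
by apply: (nearby_far hD _ _ eD); apply/andP.
Qed.

(** Disjoint compact sets would be more than [e *+ 2] apart for small [e], against
    [interleaved_chains_meet] for fine chains in them. *)
Lemma interleaved_compacts_meet K L p q p' q' : compact K -> compact L ->
  (forall r, K r -> 0 <= r.2) -> (forall r, L r -> 0 <= r.2) ->
  well_chained K p q -> well_chained L p' q' ->
  [/\ p.2 = 0, q.2 = 0, p'.2 = 0 & q'.2 = 0] ->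
  p.1 < p'.1 -> p'.1 < q.1 -> q.1 < q'.1 -> K `&` L !=set0.
Proof.
move=> cK cL K0 L0 jK jL [p0 q0 p'0 q'0] h1 h2 h3.
apply/set0P/negP => /eqP KL.
near (0 : R)^'+ => e.
have e0 : 0 < e by [].
have [s [s1 s2 s3]] := jK e e0; have [t [t1 t2 t3]] := jL e e0.
have [r [r' [/s3 Kr /t3 Lr]]] : exists r r',
    [/\ r \in p :: s, r' \in p' :: t & nearby (e *+ 2) r r'].
  apply: (interleaved_chains_meet e0 t1 s1); rewrite ?s2 ?t2 //.
    by move=> r /s3/K0.
  by move=> r /t3/L0.
apply/negP; move: r r' Kr Lr; near: e; exact: compact_separated.
Unshelve. all: by end_near. Qed.

End WellChained.

(** * Two involutions of a finite set *)

Lemma fixfree_involution_even (T : finType) (f : T -> T) (A : {set T}) :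
  {in A, forall x, f x \in A} -> {in A, forall x, f x != x} ->
  {in A, involutive f} -> ~~ odd #|A|.
Proof.
have [n] := ubnP #|A|; elim: n A => // n IH A An fA fn fK.
have [->|[x xA]] := set_0Vmem A; first by rewrite cards0.
have xfA : [set x; f x]%SET \subset A.
  by apply/fintype.subsetP => y; rewrite !inE => /orP[] /eqP-> //; apply: fA.
have c2 : #|[set x; f x]%SET| = 2%N by rewrite cards2 eq_sym fn.
rewrite -(cardsID [set x; f x]%SET A) (finset.setIidPr xfA) oddD c2 /=.
apply: IH.
- move: An; rewrite -(cardsID [set x; f x]%SET A) (finset.setIidPr xfA) c2; lia.
- move=> y; rewrite !inE !negb_or => /andP[/andP[yx yfx] yA]; rewrite fA // andbT.
  apply/andP; split; apply/eqP => e.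
    by rewrite -(fK y yA) e eqxx in yfx.
  by rewrite -(fK y yA) e (fK x xA) eqxx in yx.
- by move=> y /finset.setDP[yA _]; apply: fn.
- by move=> y /finset.setDP[yA _]; apply: fK.
Qed.

Section Dihedral.
Variables (V : finType) (s m : V -> V).
Hypotheses (sK : involutive s) (mK : involutive m) (mn : forall v, m v != v).

Definition rotation v := s (m v).
Local Notation rho := rotation.

Lemma rotation_inj : injective rho.
Proof. exact: inj_comp (inv_inj sK) (inv_inj mK). Qed.

Lemma iter_rotation_inj n : injective (iter n rho).
Proof. by elim: n => // n IH x y /= /rotation_inj/IH. Qed.

(** [s] conjugates the rotation to its inverse, so reflecting the [n]-th iterate of a fixed point
    gives the iterate of index [-n]. *)
Lemma iter_rotation_reflect n v :
  s v = v -> iter n rho (s (iter n rho v)) = v.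
Proof.
move=> sv; elim: n => // n IH.
by rewrite iterSr /= {2}/rho /rho sK mK.
Qed.

Lemma orbit_reflect v w : s v = v -> fconnect rho v w -> fconnect rho v (s w).
Proof.
move=> sv vw; rewrite (fconnect_sym rotation_inj).
have := iter_rotation_reflect (findex rho v w) sv; rewrite (iter_findex vw).
by move=> {1}<-; exact: fconnect_iter.
Qed.

Lemma orbit_mate v w : s v = v -> fconnect rho v w -> fconnect rho v (m w).
Proof.
move=> sv vw; rewrite -[m w]sK; apply: orbit_reflect => //.
by apply: connect_trans vw (fconnect1 _ _).
Qed.

Lemma iter_rotation_lt_order v n :
  (n < order rho v)%N -> iter n rho v = v -> n = 0%N.
Proof. by move=> /findex_iter {2}<- ->; rewrite findex0. Qed.

Lemma order_rotation_even v : s v = v -> ~~ odd (order rho v).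
Proof.
move=> sv; apply/negP => oddN; set k := (order rho v)./2.
have Nk : order rho v = (k.+1 + k)%N.
  by rewrite -[LHS]odd_double_half oddN -addnn.
have /eqP[] := mn (iter k rho v).
(* With period [2k + 1], both the [k]-th iterate and its image under [m] reach [v] after [k.+1] more
   rotations, so [m] would fix that iterate. *)
apply: (@iter_rotation_inj k.+1); rewrite -iterD -Nk (iter_order rotation_inj).
rewrite -[RHS](iter_rotation_reflect k.+1 sv); congr (iter _ _ _).
by rewrite /= {2}/rho sK.
Qed.

Definition antipode v := iter (order rho v)./2 rho v.

Lemma order_rotation_half v : s v = v ->
  order rho v = ((order rho v)./2 + (order rho v)./2)%N.
Proof.
by move=> /order_rotation_even e; rewrite addnn even_halfK.
Qed.

Lemma fconnect_antipode v : fconnect rho v (antipode v).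
Proof. exact: fconnect_iter. Qed.

Lemma reflect_antipode v : s v = v -> s (antipode v) = antipode v.
Proof.
move=> sv; apply: (@iter_rotation_inj (order rho v)./2).
by rewrite iter_rotation_reflect // -iterD -order_rotation_half // iter_order //;
  exact: rotation_inj.
Qed.

Lemma antipode_neq v : s v = v -> antipode v != v.
Proof.
move=> sv; apply/eqP => e.
have := order_gt0 rho v; have := order_rotation_half sv.
move=> h1 h2; have := iter_rotation_lt_order _ e; lia.
Qed.

Lemma antipodeK v : s v = v -> antipode (antipode v) = v.
Proof.
move=> sv; have -> : antipode (antipode v) = iter (order rho v)./2 rho (antipode v).
  (* The order is the size of the orbit, hence the same at [v] and at its antipode. *)
  rewrite {1}/antipode; congr (iter _./2 _ _).
  apply: eq_card => w; rewrite !inE.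
  exact/esym/(same_connect (fconnect_sym rotation_inj))/fconnect_antipode.
rewrite -iterD -order_rotation_half // iter_order //; exact: rotation_inj.
Qed.

(** If the [n]-th iterate is fixed by [s], then [2n] rotations fix [v]; as [n] is below the order,
    [2n] is 0 or the order. *)
Lemma orbit_fixed v w :
  s v = v -> s w = w -> fconnect rho v w -> w = v \/ w = antipode v.
Proof.
move=> sv sw vw; have nN := findex_max vw; have en := iter_findex vw.
set n := findex rho v w in nN en.
have := iter_rotation_reflect n sv; rewrite en sw -{1}en -iterD => h.
have [n2|n2] := ltnP (n + n) (order rho v).
  by left; rewrite -en; have -> : n = 0%N by have := iter_rotation_lt_order n2 h; lia.
right; rewrite -en /antipode; congr iter.
have h' : iter (n + n - order rho v) rho v = v.
  by rewrite -[X in iter _ _ X = _](iter_order rotation_inj v) -iterD subnK.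
by have := iter_rotation_lt_order _ h'; have := order_rotation_half sv; lia.
Qed.

End Dihedral.

(** * The orbits of a matching and its mirror image *)

Section Folding.
Variables (R : realType) (c : R).
Implicit Types (p q : R * R) (e : R).

(** Besides folding, this moves the line to height 0, where the crossing argument expects the
    endpoints. *)
Definition fold_plane p : R * R := (p.1, `|p.2 - c|).

Lemma mirrorK p : mirror c (mirror c p) = p.
Proof. by case: p => x y; rewrite /mirror /= mulr2n opprB addrCA subrr addr0. Qed.

Lemma fold_mirror p : fold_plane (mirror c p) = fold_plane p.
Proof.
rewrite /fold_plane /mirror /= -normrN; congr (_, `|_|).
by rewrite mulr2n; lra.
Qed.

Lemma fold_plane_eq p q : fold_plane p = fold_plane q -> q = p \/ q = mirror c p.
Proof.
case: p q => [x y] [x' y'] [-> /eqP]; rewrite eqr_norm2 => /orP[] /eqP h.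
  by left; congr (_, _); lra.
by right; rewrite /mirror /= mulr2n; congr (_, _); lra.
Qed.

Lemma nearby_fold e p q : nearby e p q -> nearby e (fold_plane p) (fold_plane q).
Proof.
move=> /andP[h1 h2]; apply/andP; split => //=.
rewrite (le_lt_trans (ler_dist_dist _ _)) //.
by rewrite opprB addrA subrK.
Qed.

Lemma continuous_fold : continuous fold_plane.
Proof.
move=> p; apply/cvg_ballP => e e0; apply: filterS (nbhsx_ballx p e e0) => q [h1 h2].
have /andP[? ?] := @nearby_fold e p q (introT andP (conj h1 h2)).
by split.
Qed.

Lemma fold_ge0 p : 0 <= (fold_plane p).2.
Proof. exact: normr_ge0. Qed.

End Folding.

(** * Reflection of vertices and edges, and partners in a perfect matching *)

Section Symmetric.
Variables (R : realType) (G : plane_graph R) (c : R).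
Hypothesis hsym : pg_symmetric G c.
Implicit Types (v w x y : G) (e f : {set G}) (mu : {set {set G}}).

Lemma edge_setP e :
  reflect (exists x y, pg_adj x y /\ e = [set x; y]%SET) (e \in pg_edges G).
Proof.
rewrite inE; apply: (iffP existsP) => [[x /existsP[y /andP[xy /eqP ->]]]|].
  by exists x, y.
by move=> [x [y [xy ->]]]; exists x; apply/existsP; exists y; rewrite xy eqxx.
Qed.

Lemma adj_neq x y : pg_adj x y -> x != y.
Proof. by move=> xy; apply: contraTneq xy => ->; rewrite pg_adj_irr. Qed.

Lemma set2_cancel x y y' : [set x; y]%SET = [set x; y']%SET -> x != y -> y = y'.
Proof.
move=> E xy; have := set22 x y; rewrite E !inE eq_sym (negbTE xy) /=.
by move=> /eqP.
Qed.

Lemma edge_mem e x : e \in pg_edges G -> x \in e ->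
  exists y, pg_adj x y /\ e = [set x; y]%SET.
Proof.
move=> /edge_setP[u [w [uw ->]]]; rewrite !inE => /orP[] /eqP ->.
  by exists w.
by exists u; rewrite finset.setUC pg_adj_sym.
Qed.

Lemma edge_adj x y : [set x; y]%SET \in pg_edges G -> pg_adj x y.
Proof.
move=> E; have [z [xz eq]] := edge_mem E (set21 x y).
have xz' := adj_neq xz.
by rewrite (set2_cancel (esym eq) xz') in xz.
Qed.

Lemma arcs_meet e f p : e \in pg_edges G -> f \in pg_edges G ->
  pg_arc e p -> pg_arc f p -> exists v, v \in e /\ v \in f.
Proof.
move=> eE fE ep fp; have [E|nef] := eqVneq e f.
  have /edge_setP[x [y [_ E']]] := eE.
  by exists x; rewrite -E E' set21.
by have [v [ve vf _]] := pg_arc_disjoint eE fE nef ep fp; exists v.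
Qed.

(** The reflection as a total map on vertices; symmetry of the graph ensures that the [pick]
    succeeds. *)
Definition vrefl v := odflt v [pick v' : G | pg_pos v' == mirror c (pg_pos v)].

Lemma pos_vrefl v : pg_pos (vrefl v) = mirror c (pg_pos v).
Proof.
rewrite /vrefl; case: pickP => [w /eqP //|no].
by have [w /eqP] := hsym.1 v; rewrite no.
Qed.

Lemma vreflK : involutive vrefl.
Proof. by move=> v; apply: (@pg_pos_inj _ G); rewrite !pos_vrefl mirrorK. Qed.

Lemma vrefl_inj : injective vrefl.
Proof. exact: inv_inj vreflK. Qed.

Lemma vrefl_fixed v : vrefl v = v <-> on_line c v.
Proof.
rewrite /on_line; split=> h.
  by have := congr1 snd (pos_vrefl v); rewrite h /= mulr2n => e; lra.
apply: (@pg_pos_inj _ G); rewrite pos_vrefl /mirror -h mulr2n addrK.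
by case: (pg_pos v).
Qed.

Lemma mirror_edgeE e : mirror_edge c e = (vrefl @: e)%SET.
Proof.
apply/setP => v; rewrite inE; apply/exists_inP/imsetP => -[u ue].
  by move=> /eqP h; exists u => //; apply: (@pg_pos_inj _ G); rewrite pos_vrefl.
by move=> ->; exists u => //; rewrite pos_vrefl.
Qed.

Lemma mirror_edgeK : involutive (@mirror_edge R G c).
Proof.
move=> e; rewrite !mirror_edgeE -imset_comp -[RHS]imset_id.
by apply: eq_imset => v /=; rewrite vreflK.
Qed.

Lemma mirror_edge_set2 x y :
  mirror_edge c [set x; y]%SET = [set vrefl x; vrefl y]%SET.
Proof. by rewrite mirror_edgeE imsetU !imset_set1. Qed.

Lemma mem_mirror_edge v e : (v \in mirror_edge c e) = (vrefl v \in e).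
Proof. by rewrite mirror_edgeE -{1}(vreflK v) mem_imset //; exact: vrefl_inj. Qed.

Lemma mirror_edge_edges e : (mirror_edge c e \in pg_edges G) = (e \in pg_edges G).
Proof.
apply/idP/idP => [/hsym.2[]|/hsym.2[] //]; by rewrite mirror_edgeK.
Qed.

Definition mate mu v := odflt v [pick w : G | (w != v) && ([set v; w]%SET \in mu)].

Section Mate.
Variable mu : {set {set G}}.
Hypothesis pm : perfect_matching mu.

Lemma matching_edges e : e \in mu -> e \in pg_edges G.
Proof. by have /andP[/fintype.subsetP h _] := pm; exact: h. Qed.

Lemma matching_unique v e f :
  e \in mu -> f \in mu -> v \in e -> v \in f -> e = f.
Proof.
move=> em fm ve vf; have /andP[_ /forallP/(_ v)/cards1P[g E]] := pm.
have : e \in [set g]%SET by rewrite -E inE em.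
have : f \in [set g]%SET by rewrite -E inE fm.
by rewrite !inE => /eqP -> /eqP ->.
Qed.

Lemma matching_cover v : exists2 e, e \in mu & v \in e.
Proof.
have /andP[_ /forallP/(_ v)/cards1P[g E]] := pm.
have : g \in [set e in mu | v \in e]%SET by rewrite E set11.
by rewrite inE => /andP[]; exists g.
Qed.

Lemma mateP v : (mate mu v != v) && ([set v; mate mu v]%SET \in mu).
Proof.
rewrite /mate; case: pickP => [w //|no].
have [e em ve] := matching_cover v.
have [y [vy E]] := edge_mem (matching_edges em) ve.
by have := no y; rewrite -E em eq_sym adj_neq.
Qed.

Lemma mate_mem v : [set v; mate mu v]%SET \in mu.
Proof. by case/andP: (mateP v). Qed.

Lemma mate_neq v : mate mu v != v.
Proof. by case/andP: (mateP v). Qed.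

Lemma mate_eq v w : [set v; w]%SET \in mu -> w = mate mu v.
Proof.
move=> h; apply/esym/(@set2_cancel v); last by rewrite eq_sym mate_neq.
by apply: (@matching_unique v _ _ (mate_mem v) h); rewrite set21.
Qed.

Lemma mateK : involutive (mate mu).
Proof. by move=> v; apply/esym/mate_eq; rewrite finset.setUC mate_mem. Qed.

End Mate.

End Symmetric.

(** * Folded orbits and the noncrossing pairing of the vertices on the line *)

Section Components.
Variables (R : realType) (G : plane_graph R) (c : R).
Hypothesis hsym : pg_symmetric G c.
Variable mu : {set {set G}}.
Hypothesis pm : perfect_matching mu.
Implicit Types (v w x y : G).

Let refl := @vrefl R G c.
Let m := @mate R G mu.
Let rho := rotation refl m.
Let reflK : involutive refl := vreflK hsym.
Let matK : involutive m := mateK pm.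
Let mn : forall v, m v != v := mate_neq pm.
Let tau := antipode refl m.

(** A union over the whole orbit rather than a parametrised curve: the crossing argument asks only
    for compactness and fine chains. *)
Definition folded_orbit v : set (R * R) :=
  (\bigcup_(w in [set w | fconnect rho v w])
    (fold_plane c @` pg_arc [set w; m w]%SET))%classic.

Lemma mate_arc w : is_arc (pg_arc [set w; m w]%SET) (pg_pos w) (pg_pos (m w)).
Proof. exact/pg_arcP/edge_adj/(matching_edges pm)/(mate_mem pm). Qed.

Lemma compact_folded_orbit v : compact (folded_orbit v).
Proof.
rewrite /folded_orbit.
have -> : [set w | fconnect rho v w]%classic =
    [set w | (w \in enum G) && fconnect rho v w]%classic.
  by apply/seteqP; split => w /=; rewrite mem_enum.
rewrite classical_sets.bigcup_seq_cond; apply: bigsetU_compact => w _.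
apply: continuous_compact; last exact: compact_arc (mate_arc w).
exact/continuous_subspaceT/continuous_fold.
Qed.

(** Successive folded arcs join up, since [rho w] is the mirror image of [m w] and both fold to the
    same point. *)
Lemma well_chained_folded_orbit v n :
  well_chained (folded_orbit v) (fold_plane c (pg_pos v))
    (fold_plane c (pg_pos (iter n rho v))).
Proof.
elim: n => [|n IH].
  move=> e e0; exists [::]; split=> // p; rewrite inE => /eqP ->.
  exists v => /=; first exact: connect0.
  have [g [_ _ g0 _ <-]] := mate_arc v.
  by exists (pg_pos v) => //; exists 0 => //=; rewrite in_itv /= lexx ler01.
apply: well_chained_trans IH _; rewrite iterS; set w := iter n rho v.
rewrite -[rho w]/(refl (m w)) (pos_vrefl hsym) fold_mirror.
apply: (@well_chained_sub _ (fold_plane c @` pg_arc [set w; m w]%SET)%classic).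
  by move=> p hp; exists w => //; exact: fconnect_iter.
apply: well_chained_image (arc_well_chained (mate_arc w)).
by move=> *; exact: nearby_fold.
Qed.

Lemma orbit_edge v w x : refl v = v -> fconnect rho v w ->
  x \in [set w; m w]%SET -> fconnect rho v x.
Proof.
move=> sv vw; rewrite !inE => /orP[] /eqP -> //.
exact: (orbit_mate reflK matK).
Qed.

Lemma folded_orbits_meet v w : refl v = v -> refl w = w ->
  (folded_orbit v `&` folded_orbit w !=set0)%classic -> fconnect rho v w.
Proof.
move=> sv sw [_ [[x /= vx [p ep <-]] [y /= wy [q fq /esym/fold_plane_eq pq]]]].
have eE : [set x; m x]%SET \in pg_edges G.
  exact/(matching_edges pm)/(mate_mem pm).
have fE : [set y; m y]%SET \in pg_edges G.
  exact/(matching_edges pm)/(mate_mem pm).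
have symr := fconnect_sym (rotation_inj reflK matK).
case: pq => qE.
  have [|u [ue uf]] := arcs_meet eE fE ep; first by rewrite -qE.
  apply: connect_trans (orbit_edge sv vx ue) _.
  by rewrite symr; exact: (orbit_edge sw wy uf).
(* Here the arc of the first edge meets that of the mirror image of the second; the shared vertex is
   reflected back into the second edge. *)
have [f'E arcE] := hsym.2 _ fE.
have [|u [ue uf]] := arcs_meet eE f'E ep.
  by rewrite arcE; exists q => //; rewrite qE mirrorK.
apply: connect_trans (orbit_edge sv vx ue) _; rewrite symr.
rewrite -(reflK u); apply: (orbit_reflect reflK matK) => //.
by apply: (orbit_edge sw wy); rewrite -(mem_mirror_edge hsym).
Qed.

(** Interleaved ends make the two folded orbits meet, so [w] lies in the orbit of [v] and is [v] or
    its antipode, against the strict inequalities. *)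
Lemma antipodes_noncrossing v w : refl v = v -> refl w = w ->
  (pg_pos v).1 < (pg_pos w).1 -> (pg_pos w).1 < (pg_pos (tau v)).1 ->
  (pg_pos (tau v)).1 < (pg_pos (tau w)).1 -> False.
Proof.
move=> sv sw h1 h2 h3.
have flat u : refl u = u -> (fold_plane c (pg_pos u)).2 = 0.
  by move=> /(vrefl_fixed hsym) h; rewrite /= h subrr normr0.
have fixt u : refl u = u -> refl (tau u) = tau u.
  exact: (reflect_antipode reflK matK mn).
have : (folded_orbit v `&` folded_orbit w !=set0)%classic.
  have fo u r : folded_orbit u r -> 0 <= r.2.
    by move=> [x _ [p _ <-]]; exact: fold_ge0.
  apply: (interleaved_compacts_meet (@compact_folded_orbit v)
    (@compact_folded_orbit w) (fo v) (fo w)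
    (@well_chained_folded_orbit v (order rho v)./2)
    (@well_chained_folded_orbit w (order rho w)./2)) => //.
  by split; apply: flat => //; apply: fixt.
move=> /(folded_orbits_meet sv sw) /(orbit_fixed reflK matK mn sv sw) [] E.
  by rewrite E ltxx in h1.
by rewrite E ltxx in h2.
Qed.

Section Alternating.
Variables (k : nat) (a b : 'I_k -> G).
Hypothesis hline : forall v : G,
  on_line c v <-> (exists i, v = a i) \/ (exists i, v = b i).
Hypothesis hab : forall i : 'I_k, (pg_pos (a i)).1 < (pg_pos (b i)).1.
Hypothesis hba : forall i j : 'I_k, (i < j)%N ->
  (pg_pos (b i)).1 < (pg_pos (a j)).1.

Lemma abscissa_aa i j : (pg_pos (a i)).1 <= (pg_pos (a j)).1 -> (i <= j)%N.
Proof.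
move=> h; rewrite leqNgt; apply/negP => ji.
have := lt_trans (hab j) (hba ji); lra.
Qed.

Lemma abscissa_ab i j : (pg_pos (a i)).1 <= (pg_pos (b j)).1 -> (i <= j)%N.
Proof. by move=> h; rewrite leqNgt; apply/negP => /hba; lra. Qed.

Lemma abscissa_ba i j : (pg_pos (b i)).1 < (pg_pos (a j)).1 -> (i < j)%N.
Proof.
move=> h; rewrite ltnNge leq_eqVlt; apply/negP => /orP[/eqP/val_inj E|].
  by have := hab i; rewrite -E in h *; lra.
by move=> /hba; have := hab i; have := hab j; lra.
Qed.

Lemma a_inj : injective a.
Proof.
by move=> i j E; apply/val_inj/eqP; rewrite eqn_leq !abscissa_aa // E lexx.
Qed.

Lemma b_inj : injective b.
Proof.
move=> i j E; apply/val_inj/eqP; rewrite eqn_leq !abscissa_ab //.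
  by rewrite E ltW.
by rewrite -E ltW.
Qed.

Lemma on_line_eq v w : on_line c v -> on_line c w ->
  (pg_pos v).1 = (pg_pos w).1 -> v = w.
Proof.
rewrite /on_line => hv hw h; apply: (@pg_pos_inj _ G).
by rewrite [LHS]surjective_pairing [RHS]surjective_pairing hv hw h.
Qed.

Lemma reflect_a i : refl (a i) = a i.
Proof. by apply/(vrefl_fixed hsym)/hline; left; exists i. Qed.

(* There are equally many [a]'s and [b]'s from [a i] (included) to [a j]
   (excluded), so an odd number of vertices of the line lies strictly between
   them, whereas noncrossing pairing would make that number even. *)
Lemma antipode_a (i j : 'I_k) : (i < j)%N -> tau (a i) <> a j.
Proof.
move=> ij tij.
pose T := [set v : G | `[< on_line c v >] &&
  ((pg_pos (a i)).1 <= (pg_pos v).1 < (pg_pos (a j)).1)]%SET.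
pose I := [set l : 'I_k | (i <= l < j)%N]%SET.
have aT : a i \in T.
  rewrite inE lexx (lt_trans (hab i) (hba ij)) /= andbT.
  by apply/asboolP/hline; left; exists i.
have evenT : ~~ odd #|T|.
  have -> : T = ((a @: I) :|: (b @: I))%SET.
    apply/setP => v; rewrite !inE; apply/idP/idP.
      move=> /andP[/asboolP/hline [] [l ->] /andP[h1 h2]]; apply/orP; [left|right].
        apply: imset_f; rewrite inE abscissa_aa //= ltnNge; apply/negP => jl.
        move: jl; rewrite leq_eqVlt => /orP[/eqP/val_inj E|/hba].
          by rewrite E ltxx in h2.
        by have := hab j; lra.
      by apply: imset_f; rewrite inE abscissa_ab ?abscissa_ba.
    move=> /orP[] /imsetP[l]; rewrite inE => /andP[il lj] ->; apply/and3P; split.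
    - by apply/asboolP/hline; left; exists l.
    - by move: il; rewrite leq_eqVlt => /orP[/eqP/val_inj->//|/hba]; have := hab i; lra.
    - by have := hba lj; have := hab l; lra.
    - by apply/asboolP/hline; right; exists l.
    - move: il; rewrite leq_eqVlt => /orP[/eqP/val_inj->//|/hba].
        exact/ltW/hab.
      by have := hab i; have := hab l; lra.
    - exact: hba.
  rewrite cardsU (card_imset _ a_inj) (card_imset _ b_inj).
  suff -> : ((a @: I) :&: (b @: I))%SET = finset.set0.
    by rewrite cards0 subn0 addnn odd_double.
  apply/setP => v; rewrite !inE; apply/negP.
  move=> /andP[/imsetP[l _ ->] /imsetP[l' _ E]].
  have /val_inj E' : val l = val l'.
    have l1 : (l <= l')%N by apply: abscissa_ab; rewrite E.
    apply/eqP; rewrite eqn_leq l1 leqNgt; apply/negP => ll.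
    by have := hba ll; have := hab l; have := hab l'; rewrite E; lra.
  by have := hab l; rewrite E E' ltxx.
(* As [a j] is the antipode of [a i], noncrossing makes [tau] a fixed-point-free involution of the
   vertices strictly between them. *)
have : ~~ odd #|(T :\ a i)%SET|.
  have inT w : w \in (T :\ a i)%SET -> [/\ refl w = w,
      (pg_pos (a i)).1 < (pg_pos w).1 & (pg_pos w).1 < (pg_pos (tau (a i))).1].
    rewrite !inE => /and3P[wa /asboolP lw /andP[h1 h2]].
    rewrite tij; split=> //; first exact/(vrefl_fixed hsym).
    rewrite lt_neqAle h1 andbT; apply: contraNneq wa => E.
    by apply/eqP/esym/on_line_eq => //; apply/hline; left; exists i.
  have tauK u : refl u = u -> tau (tau u) = u by exact: (antipodeK reflK matK mn).
  apply: (@fixfree_involution_even _ tau) => w /inT[sw h1 h2].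
  - have stw : refl (tau w) = tau w by exact: (reflect_antipode reflK matK mn).
    rewrite !inE; apply/and4P; split.
    + by apply/eqP => E; move: h2; rewrite -E tauK // ltxx.
    + exact/asboolP/(vrefl_fixed hsym).
    (* Otherwise the order is [tau w], [a i], [w], [a j]: the two pairs cross. *)
    + rewrite leNgt; apply/negP => h3.
      by apply: (antipodes_noncrossing stw (reflect_a i) h3); rewrite tauK.
    (* Equality with [a j] would give [w = a i]; beyond [a j] the order [a i], [w], [a j], [tau w]
       crosses. *)
    + rewrite -tij ltNge le_eqVlt; apply/negP => /orP[/eqP E|h3].
        have /(congr1 tau) : tau (a i) = tau w.
          apply: on_line_eq E; apply/(vrefl_fixed hsym) => //.
          exact: (reflect_antipode reflK matK mn) (reflect_a i).
        by rewrite !tauK ?reflect_a // => E'; rewrite E' ltxx in h1.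
      exact: (antipodes_noncrossing (reflect_a i) sw h1 h2 h3).
  - exact: (antipode_neq reflK matK mn).
  - exact: tauK.
by move: evenT; rewrite (cardsD1 (a i)) aT /= => /negPn ->.
Qed.

(** Only the antipode could be a second vertex of the line in the orbit; being antipodal is
    symmetric, so [antipode_a] excludes both orders of the indices. This separates the prescribed
    edges. *)
Lemma orbit_a i j : fconnect rho (a i) (a j) -> i = j.
Proof.
move=> /(orbit_fixed reflK matK mn (reflect_a i) (reflect_a j))[/a_inj //|E].
case: (ltngtP i j) => [/antipode_a/(_ (esym E))//|ji|/val_inj//].
case: (antipode_a ji); rewrite E.
exact: (antipodeK reflK matK mn) (reflect_a i).
Qed.

End Alternating.

End Components.

(** * Reflecting a matching inside a component *)

Section Toggle.
Variables (R : realType) (G : plane_graph R) (c : R).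
Hypothesis hsym : pg_symmetric G c.
Implicit Types (v w x y : G) (e f : {set G}) (mu : {set {set G}}) (C : {set G}).

(** Defined by connectivity instead of as an orbit, so that both stability properties hold for any
    set [mu]; [component_orbit] makes the link with orbits. *)
Definition component mu v : {set G} :=
  [set w | connect (fun x y => (y == vrefl c x) || ([set x; y]%SET \in mu)) v w]%SET.

Definition refl_stable C := {in C, forall w, vrefl c w \in C}.
Definition edge_stable mu C := forall w y, w \in C -> [set w; y]%SET \in mu -> y \in C.

Lemma component_id mu v : v \in component mu v.
Proof. by rewrite inE connect0. Qed.

Lemma component_refl_stable mu v : refl_stable (component mu v).
Proof.
by move=> w; rewrite !inE => h; apply: connect_trans h (connect1 _); rewrite eqxx.
Qed.

Lemma component_edge_stable mu v : edge_stable mu (component mu v).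
Proof.
move=> w y; rewrite !inE => h wy; apply: connect_trans h (connect1 _).
by rewrite wy orbT.
Qed.

Lemma component_sub mu v C :
  v \in C -> refl_stable C -> edge_stable mu C -> component mu v \subset C.
Proof.
move=> vC rC eC; apply/fintype.subsetP => w; rewrite inE => /connectP[s].
elim: s v vC => [|y s IH] v vC /=; first by move=> _ ->.
by move=> /andP[/orP[/eqP-> | /eC-/(_ vC) yC] p l]; apply: IH p l => //; apply: rC.
Qed.

Lemma component_orbit mu v w : perfect_matching mu -> vrefl c v = v ->
  w \in component mu v -> fconnect (rotation (vrefl c) (mate mu)) v w.
Proof.
move=> pm sv; set D := [set w | fconnect (rotation (vrefl c) (mate mu)) v w]%SET.
suff /fintype.subsetP/(_ w) : component mu v \subset D by rewrite [w \in D]inE.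
apply: component_sub; first by rewrite inE connect0.
  by move=> x; rewrite !inE; exact: (orbit_reflect (vreflK hsym) (mateK pm)).
move=> x y; rewrite !inE => vx /(mate_eq pm) ->.
exact: (orbit_mate (vreflK hsym) (mateK pm)).
Qed.

Definition swap C e := if e \subset C then mirror_edge c e else e.

(** The preimage under [swap] gives membership by computation; [toggleE] supplies the image form
    used for products. *)
Definition toggle C mu : {set {set G}} := [set e | swap C e \in mu]%SET.

Lemma mirror_edge_sub C e : refl_stable C -> (mirror_edge c e \subset C) = (e \subset C).
Proof.
move=> rC; apply/fintype.subsetP/fintype.subsetP => h x xe.
  by rewrite -(vreflK hsym x); apply/rC/h; rewrite (mem_mirror_edge hsym) (vreflK hsym).
by rewrite -(vreflK hsym x); apply/rC/h; rewrite -(mem_mirror_edge hsym).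
Qed.

Lemma swapK C : refl_stable C -> involutive (swap C).
Proof.
move=> rC e; rewrite /swap; case: (boolP (e \subset C)) => [eC|/negbTE -> //].
by rewrite mirror_edge_sub // eC (mirror_edgeK hsym).
Qed.

Lemma toggleK C mu : refl_stable C -> toggle C (toggle C mu) = mu.
Proof. by move=> rC; apply/setP => e; rewrite !inE swapK. Qed.

Lemma toggleE C mu : refl_stable C -> toggle C mu = (swap C @: mu)%SET.
Proof.
move=> rC; apply/setP => e; rewrite inE -{2}(swapK rC e) mem_imset //.
exact: inv_inj (swapK rC).
Qed.

Lemma swap_edges C e : (swap C e \in pg_edges G) = (e \in pg_edges G).
Proof. by rewrite /swap; case: ifP => // _; rewrite (mirror_edge_edges hsym). Qed.

Lemma swap_out C e v : v \in e -> v \notin C -> swap C e = e.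
Proof. by move=> ve; rewrite /swap; case: ifP => // /fintype.subsetP ->. Qed.

Section Stable.
Variables (mu : {set {set G}}) (C : {set G}).
Hypotheses (pm : perfect_matching mu) (rC : refl_stable C) (eC : edge_stable mu C).

Lemma matching_edge_sub e v : e \in mu -> v \in e -> v \in C -> e \subset C.
Proof.
move=> em ve vC; have [y [_ E]] := edge_mem (matching_edges pm em) ve.
rewrite E in em *; apply/fintype.subsetP => x; rewrite !inE => /orP[] /eqP -> //.
exact: eC em.
Qed.

Lemma swap_in e v : swap C e \in mu -> v \in e -> v \in C -> e \subset C.
Proof.
rewrite /swap; case: ifP => // eC' em ve vC.
by rewrite -eC'; exact: matching_edge_sub em ve vC.
Qed.

(** At a vertex outside [C] the edges are unchanged; at [v] in [C], [swap] matches them with the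
    edges of [mu] at the reflection of [v]. *)
Lemma toggle_perfect_matching : perfect_matching (toggle C mu).
Proof.
apply/andP; split.
  apply/fintype.subsetP => e; rewrite inE => /(matching_edges pm).
  by rewrite swap_edges.
apply/forallP => v; have /andP[_ /forallP card1] := pm.
have [vC|vC] := boolP (v \in C); last first.
  rewrite -(eqP (card1 v)); apply/eqP/eq_card => e; rewrite !inE.
  by case: (boolP (v \in e)) => ve; rewrite ?andbF // (swap_out ve vC).
rewrite -(eqP (card1 (vrefl c v))); apply/eqP.
rewrite -[RHS](card_imset _ (inv_inj (swapK rC))); apply: eq_card => e.
rewrite -[e in RHS](swapK rC) mem_imset; last exact: inv_inj (swapK rC).
rewrite !inE; case: (boolP (swap C e \in mu)) => //= em.
apply/idP/idP => [ve|].
  have eC' := swap_in em ve vC.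
  by rewrite /swap eC' (mem_mirror_edge hsym) (vreflK hsym).
move=> ve; have := matching_edge_sub em ve (rC vC).
move: ve; rewrite /swap; case: ifP => [eC' | -> //].
by rewrite (mem_mirror_edge hsym) (vreflK hsym).
Qed.

Lemma toggle_edge_stable : edge_stable (toggle C mu) C.
Proof.
move=> w y wC; rewrite inE => em.
have /fintype.subsetP := swap_in em (set21 w y) wC.
by apply; rewrite set22.
Qed.

End Stable.

(** Needed for toggling twice to use the same set. Minimality of components gives each inclusion. *)
Lemma component_toggle mu v : perfect_matching mu ->
  component (toggle (component mu v) mu) v = component mu v.
Proof.
move=> pm; set C := component mu v.
have rC : refl_stable C by exact: component_refl_stable.
have eC : edge_stable mu C by exact: component_edge_stable.
have DC : component (toggle C mu) v \subset C.
  apply: component_sub => //; first exact: component_id.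
  exact: toggle_edge_stable.
apply/eqP; rewrite finset.eqEsubset DC /=; set D := component _ v in DC *.
have rD : refl_stable D by exact: component_refl_stable.
apply: component_sub => //; first exact: component_id.
(* An edge of [mu] from [x] to [y] is followed in the toggled matching through the reflections of
   [x] and [y]. *)
move=> x y xD xy; rewrite -(vreflK hsym y); apply: (rD (vrefl c y)).
apply: (@component_edge_stable _ _ (vrefl c x)); first exact: (rD x).
rewrite inE -(mirror_edge_set2 hsym).
have xyC : [set x; y]%SET \subset C.
  by apply: (matching_edge_sub pm eC xy (set21 x y)); exact: (fintype.subsetP DC).
by rewrite /swap mirror_edge_sub // xyC (mirror_edgeK hsym).
Qed.

Lemma toggle_component_involutive mu v : perfect_matching mu ->
  toggle (component (toggle (component mu v) mu) v) (toggle (component mu v) mu) = mu.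
Proof.
by move=> pm; rewrite component_toggle // toggleK //; exact: component_refl_stable.
Qed.

Lemma toggle_weight (W : comNzRingType) (wt : {set G} -> W) C mu :
  (forall e, e \in pg_edges G -> wt (mirror_edge c e) = wt e) ->
  refl_stable C -> perfect_matching mu ->
  matching_weight wt (toggle C mu) = matching_weight wt mu.
Proof.
move=> hwt rC pm; rewrite /matching_weight toggleE // big_imset /=; last first.
  by move=> e f _ _; exact: (inv_inj (swapK rC)).
apply: eq_bigr => e /(matching_edges pm) eE.
by rewrite /swap; case: ifP => // _; exact: hwt.
Qed.

End Toggle.

(** * Independence of the weight sum from the choice of sides *)

Theorem theorem6p2 (R : realType) (W : comNzRingType)
  (G : plane_graph R) (wt : {set G} -> W) (c : R)
  (hconn : pg_connected G)
  (hsym : pg_symmetric G c)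
  (hwt : forall e : {set G}, e \in pg_edges G -> wt (mirror_edge c e) = wt e)
  (k : nat) (a b : 'I_k -> G)
  (hline : forall v : G,
     on_line c v <-> (exists i, v = a i) \/ (exists i, v = b i))
  (hab : forall i : 'I_k, (pg_pos (a i)).1 < (pg_pos (b i)).1)
  (hba : forall i j : 'I_k, (i < j)%N -> (pg_pos (b i)).1 < (pg_pos (a j)).1)
  (s : nat) (hs : (s <= k)%N)
  (E : 'I_s -> {set G})
  (hE : forall i : 'I_s, E i \in pg_edges G)
  (hdisj : forall i j : 'I_s, i != j -> [disjoint E i & E j])
  (hinc : forall i : 'I_s, #|[set j : 'I_k | a j \in E i]| = 1%N) :
  forall I J : {set 'I_s},
    \sum_(mu in matchings_through c E I) matching_weight wt mu =
    \sum_(mu in matchings_through c E J) matching_weight wt mu.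
Proof.
have /choice[al alE] : forall i, exists l, a l \in E i.
  move=> i; have /eqP/cards1P[l h] := hinc i; exists l.
  by have := set11 l; rewrite -h inE.
have refl_al i : vrefl c (a (al i)) = a (al i) by exact: (reflect_a hsym hline).
have al_inj i j : i != j -> al i <> al j.
  move=> /hdisj/pred0P/(_ (a (al i))) /= + e.
  by rewrite alE e alE.
pose Phi i mu := toggle c (component c mu (a (al i))) mu.
(* [I] and [J] differ exactly at [i], in either direction, so [step] serves for both [Phi i] and its
   inverse. *)
have step i (I J : {set 'I_s}) : (i \in J) = ~~ (i \in I) ->
    (forall j, j != i -> (j \in J) = (j \in I)) ->
    forall mu, mu \in matchings_through c E I -> Phi i mu \in matchings_through c E J.
  move=> iJ IJ mu; rewrite !inE => /andP[pm /forallP through].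
  set C := component c mu (a (al i)).
  have rC : refl_stable c C by exact: component_refl_stable.
  have eC : edge_stable mu C by exact: component_edge_stable.
  rewrite (toggle_perfect_matching hsym pm rC eC) /=.
  apply/forallP => j; rewrite inE -/C; have := through j.
  have [->|ji] := eqVneq j i.
    (* Whichever of [E i] and its mirror image is in [mu], it contains the fixed vertex [a (al i)],
       and [C] is stable under reflection. *)
    have EC : E i \subset C.
      have := through i; case: ifP => _ em.
        exact: (matching_edge_sub pm eC em (alE i) (component_id _ _ _)).
      rewrite -(mirror_edge_sub hsym _ rC).
      apply: (matching_edge_sub pm eC em (v := a (al i))).
        by rewrite (mem_mirror_edge hsym) refl_al.
      exact: component_id.
    rewrite iJ; case: (i \in I) => /=.
      by rewrite /swap (mirror_edge_sub hsym) // EC (mirror_edgeK hsym).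
    by rewrite /swap EC.
  (* The other prescribed edges contain some [a (al j)], which lies outside [C] by [orbit_a]. *)
  rewrite IJ //; set e := (if _ then _ else _).
  have ve : a (al j) \in e.
    by rewrite /e; case: ifP => _; rewrite ?(mem_mirror_edge hsym) ?refl_al.
  rewrite (swap_out _ ve) //; apply/negP => /(component_orbit hsym pm (refl_al i)).
  move=> /(orbit_a hsym pm hline hab hba); apply: al_inj.
  by rewrite eq_sym.
have remove i (I : {set 'I_s}) : i \in I ->
    \sum_(mu in matchings_through c E I) matching_weight wt mu =
    \sum_(mu in matchings_through c E (I :\ i)%SET) matching_weight wt mu.
  move=> iI.
  have to mu : mu \in matchings_through c E I ->
      Phi i mu \in matchings_through c E (I :\ i)%SET.
    by apply: step => [|j ji]; rewrite !inE ?eqxx ?iI // ji.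
  have from mu : mu \in matchings_through c E (I :\ i)%SET ->
      Phi i mu \in matchings_through c E I.
    by apply: step => [|j ji]; rewrite !inE ?eqxx ?iI // ji.
  have PhiK J mu : mu \in matchings_through c E J -> Phi i (Phi i mu) = mu.
    by rewrite inE => /andP[pm _]; exact: (toggle_component_involutive hsym).
  rewrite (reindex_onto (Phi i) (Phi i)) => [|mu /PhiK //].
  apply: eq_big => [mu|mu /andP[]].
    apply/andP/idP => [[/to + /eqP E1]|h]; first by rewrite E1.
    by rewrite from // (PhiK _ _ h) eqxx.
  move=> /to + /eqP E1; rewrite E1 inE => /andP[pm _].
  by apply: toggle_weight => //; exact: component_refl_stable.
(* Removing the indices one at a time compares every [I] with the empty set. *)
have empty (I : {set 'I_s}) :
    \sum_(mu in matchings_through c E I) matching_weight wt mu =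
    \sum_(mu in matchings_through c E finset.set0) matching_weight wt mu.
  have [n] := ubnP #|I|; elim: n I => // n IH I In.
  have [->//|[i iI]] := set_0Vmem I.
  by rewrite (remove i I iI) IH //; move: In; rewrite (cardsD1 i) iI.
by move=> I J; rewrite (empty I) (empty J).
Qed.
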